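(* For all $n,k\geq 0$, the number $b_{n,k}(231)$ of permutations $\pi\in\mathfrak{S}_n(231)$ with $\mathrm{bdes}(\pi)=k$ is $$b_{n,k}(231)=\frac{2^{n-2k-1}}{k+1}\binom{n-1}{2k}\binom{2k}{k}.$$
   Context: $\mathfrak{S}_n$ is the set of permutations $\pi=\pi_1\pi_2\cdots\pi_n$ of $[n]=\{1,\dots,n\}$ in one-line notation, with $\mathfrak{S}_0$ consisting only of the empty word. $\mathfrak{S}_n(231)$ is the set of $\pi\in\mathfrak{S}_n$ having no length-three subsequence with the same relative order as $231$. An index $i\in[n-1]$ is a big descent of $\pi\in\mathfrak{S}_n$ if $\pi_i>\pi_{i+1}+1$; $\mathrm{bdes}(\pi)$ is the number of big descents of $\pi$.
   Formalization: At n = 0 the printed formula fails (b_{0,0}(231) = 1, but it gives 2^{-1}·C(-1,0), i.e. 1/2 or 0); the formal statement reads n-1 as 0 when n = 0, giving the correct values, and is unchanged for n ≥ 1. *)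

(* Defs.v *)
From mathcomp Require Import all_boot all_order all_fingroup all_algebra.

Set Implicit Arguments.
Unset Strict Implicit.
Unset Printing Implicit Defensive.

(* A permutation of [n] is s : 'S_n with positions and values shifted down by
   one: the letter in position i + 1 of its one-line notation is (s i).+1. All
   notions below only compare letters, or letters plus a constant, so they are
   unaffected by the shift. *)

(* f picks the positions of a subsequence of s of length size p; the pattern p
   is in one-line notation, e.g. [:: 2; 3; 1]. *)
Definition occurrence (p : seq nat) (n : nat) (s : 'S_n)
    (f : {ffun 'I_(size p) -> 'I_n}) : bool :=
  [forall x : 'I_(size p), forall y : 'I_(size p), (x < y) ==> (f x < f y)] &&
  [forall x : 'I_(size p), forall y : 'I_(size p),
     (nth 0 p x < nth 0 p y) == (s (f x) < s (f y))].

Definition avoids (p : seq nat) (n : nat) (s : 'S_n) : bool :=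
  ~~ [exists f : {ffun 'I_(size p) -> 'I_n}, occurrence s f].

Definition big_descent (n : nat) (s : 'S_n) (i : 'I_n) : bool :=
  [exists j : 'I_n, (j == i.+1 :> nat) && (s i > s j + 1)].

Definition bdes (n : nat) (s : 'S_n) : nat := #|[set i | big_descent s i]|.

(* When a formula for b n k p involves n - 1, the case n = 0 needs care: the
   empty permutation gives b 0 0 p = 1 for every nonempty p. For p = 231 the
   expression 2^(n-2k-1) / (k+1) * 'C(n-1, 2k) * 'C(2k, k) yields this value
   with n - 1 read as n.-1 (that is, 0), but not with n - 1 = -1. *)
Definition b (n k : nat) (p : seq nat) : nat :=
  #|[set s : 'S_n | avoids p s & bdes s == k]|.

(* Main.v *)
Require Import Defs.
From mathcomp Require Import all_boot all_order all_fingroup all_algebra.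
From mathcomp Require Import zify ring.
Import Order.TTheory GRing.Theory Num.Theory.
Local Open Scope ring_scope.

(** A 231-avoiding word with first letter [m] is [m u v], where [u] and [v] are
    231-avoiding, [u] consists of the letters below [m] and [v] of those above.
    The step from [u] to [v] is an ascent, and the step from [m] to [u] is a big
    descent unless [u] is empty or starts with its maximum. Hence the generating
    functions [F] of all such words and [M] of the nonempty ones starting with
    their maximum, with [t] marking big descents, satisfy [F = 1 + M F] and
    [M = x (1 + M + t (F - 1 - M))]. Multiplying the second equation by [F]
    gives [G = x (1 + 2 G + t G^2)] for [G = F - 1], the equation of Motzkin
    paths with two kinds of level steps and weight [t] on up steps. *)

(** * The Motzkin recurrence *)

(** Sort the subsets of size [p + q + 1] of [m + 1] points by their [p + 1]-st smallest point
    [i]. *)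
Lemma bin_convolution (m p q : nat) :
  (\sum_(i < m.+1) 'C(i, p) * 'C(m - i, q) = 'C(m.+1, (p + q).+1))%N.
Proof.
elim: m p q => [|m IHm] p q.
  by rewrite big_ord1 subn0; case: p q => [|p] [|q] //=; rewrite bin_small ?muln0.
case: q => [|q].
  rewrite big_ord_recr /= subnn bin0 muln1 addn0 binS -[in RHS](addn0 p) -IHm.
  by rewrite addn0; congr (_ + _)%N; apply: eq_bigr => i _; rewrite !bin0.
rewrite big_ord_recr /= subnn muln0 addn0 binS -IHm addnS -IHm -big_split /=.
apply: eq_bigr => i _; rewrite -mulnDr subSn ?binS //.
by rewrite -ltnS.
Qed.

Definition catalan (n : nat) : rat := 'C(2 * n, n)%:R / n.+1%:R.

Lemma central_binS (n : nat) :
  'C(2 * n.+1, n.+1)%:R = 2 * (2 * n%:R + 1) / n.+1%:R * 'C(2 * n, n)%:R :> rat.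
Proof.
have E1 : (n.+1 * 'C(2 * n.+1, n.+1) = (2 * n).+2 * 'C((2 * n).+1, n))%N.
  by rewrite mulnS !addSn add0n -mul_bin_diag.
have E2 : ((n.+1) * 'C((2 * n).+1, n) = (2 * n).+1 * 'C(2 * n, n))%N.
  by rewrite (mul_bin_down (2 * n).+1 n); congr (_ * _)%N; lia.
have /(congr1 (fun x : nat => x%:R : rat)) := E1.
have /(congr1 (fun x : nat => x%:R : rat)) := E2.
rewrite !natrM => F2 F1.
have n1 : n.+1%:R != 0 :> rat by rewrite pnatr_eq0.
apply: (mulfI n1); rewrite F1; apply: (mulfI n1); rewrite mulrCA F2.
rewrite -!natr1 natrM; by field; rewrite natr1 n1.
Qed.

(* Gosper's telescoping antidifference of the Catalan convolution. *)
Lemma catalan_convolution_partial (n m : nat) : (m <= n.+1)%N ->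
  \sum_(i < m) catalan i * catalan (n - i) =
    'C(2 * m, m)%:R * 'C(2 * (n.+1 - m), n.+1 - m)%:R
      * (2 * m%:R - n.+1%:R) / (2 * n.+1%:R * n.+2%:R)
    + 'C(2 * n.+1, n.+1)%:R / (2 * n.+2%:R).
Proof.
elim: m => [|m IHm] le_mn.
  rewrite big_ord0 subn0 muln0 bin0.
  by field; rewrite nat1r -natrD !pnatr_eq0.
rewrite big_ord_recr /= IHm 1?ltnW // addrAC; congr (_ + _).
(* Writing [n = m + d] removes the truncated subtractions, so that [field] can conclude. *)
have [d ->] : exists d, n = (m + d)%N by exists (n - m)%N; lia.
have -> : ((m + d).+1 - m = d.+1)%N by lia.
have -> : ((m + d).+1 - m.+1 = d)%N by lia.
have -> : (m + d - m = d)%N by lia.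
rewrite /catalan !central_binS.
have P (k : nat) : k.+1%:R = k%:R + 1 :> rat by rewrite -natr1.
rewrite !P natrD.
by field; rewrite -natrD !natr1 !pnatr_eq0.
Qed.

Lemma catalanS (n : nat) :
  catalan n.+1 = \sum_(i < n.+1) catalan i * catalan (n - i).
Proof.
rewrite catalan_convolution_partial // subnn muln0 bin0 /catalan.
by field; rewrite nat1r -natrD !pnatr_eq0.
Qed.

(** Counts Motzkin paths of length [n] with [k] up steps and two kinds of level steps: place the
    [2k] other steps, arrange them as a Dyck path, color the level steps. The integer exponent may
    be negative, but then the binomial vanishes. *)
Definition motzkin_coef (n k : nat) : rat :=
  2 ^ (n%:Z - (2 * k)%:Z) * 'C(n, 2 * k)%:R * catalan k.

(** The first step is either level, of two kinds, or an up step, whose matching down step closes a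
    path of length [i] with [a] up steps. The double sum is evaluated by the Catalan and binomial
    convolutions. *)
Lemma motzkin_coef_rec (n k : nat) :
  motzkin_coef n.+1 k.+1 = 2 * motzkin_coef n k.+1
    + \sum_(i < n) \sum_(a < k.+1)
        motzkin_coef i a * motzkin_coef (n.-1 - i) (k - a).
Proof.
rewrite exchange_big /=.
have -> : \sum_(a < k.+1) \sum_(i < n)
        motzkin_coef i a * motzkin_coef (n.-1 - i) (k - a)
   = 2 ^ (n%:Z - 1 - (2 * k)%:Z) * 'C(n, (2 * k).+1)%:R * catalan k.+1.
  rewrite catalanS mulr_sumr; apply: eq_bigr => -[a /= a_le] _.
  case: n => [|n] /=; first by rewrite big_ord0 mulr0 mul0r.
  have -> : ((2 * k).+1 = (2 * a + 2 * (k - a)).+1)%N by lia.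
  rewrite -bin_convolution natr_sum mulr_sumr mulr_suml.
  apply: eq_bigr => -[i /= i_le] _.
  have -> : n.+1%:Z - 1 - (2 * k)%:Z
     = (i%:Z - (2 * a)%:Z) + ((n - i)%:Z - (2 * (k - a))%:Z) by lia.
  by rewrite expfzDr // natrM /motzkin_coef; ring.
rewrite /motzkin_coef; have -> : (2 * k.+1 = (2 * k).+2)%N by lia.
(* By Pascal's rule, the two resulting binomials are those of the level term and of the double
   sum. *)
rewrite binS natrD.
have -> : n.+1%:Z - (2 * k).+2%:Z = n%:Z - 1 - (2 * k)%:Z by lia.
have -> : n%:Z - 1 - (2 * k)%:Z = 1 + (n%:Z - (2 * k).+2%:Z) by lia.
by rewrite expfzDr // expr1z; ring.
Qed.

(* The hypotheses are [F = 1 + M F] and [M = x (1 + M + t (F - 1 - M))] read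
   coefficientwise; the conclusion is the equation of [G = F - 1]. *)
Lemma quadratic_recurrence (F M : nat -> {poly rat}) :
  F 0 = 1 -> M 0 = 0 ->
  (forall n, F n.+1 = \sum_(i < n.+1) M i.+1 * F (n - i)%N) ->
  M 1 = 1 -> (forall n, M n.+2 = M n.+1 + 'X * (F n.+1 - M n.+1)) ->
  forall n, F n.+2 = F n.+1 *+ 2 + 'X * \sum_(i < n) F i.+1 * F (n - i)%N.
Proof.
move=> F0 M0 FS M1 MS n.
rewrite FS big_ord_recl subn0 M1 mul1r mulr2n -addrA; congr (_ + _).
under eq_bigr => i _ do rewrite lift0 MS mulrDl subSS mulrBr mulrBl.
rewrite big_split sumrB /= -FS; congr (_ + _).
under [X in _ - X]eq_bigr => i _ do rewrite -mulrA.
(* The term [i = n] of the convolution is [F n.+1 * F 0 = F n.+1]; it cancels the subtracted sum,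
   which is [F n.+1] by [FS]. *)
rewrite -mulr_sumr -FS big_ord_recr /= subnn F0 mulr1 addrK mulr_sumr.
by apply: eq_bigr => i _; rewrite mulrA.
Qed.

Lemma coef_quadratic_recurrence (F : nat -> {poly rat}) : F 1 = 1 ->
  (forall n, F n.+2 = F n.+1 *+ 2 + 'X * \sum_(i < n) F i.+1 * F (n - i)%N) ->
  forall n k, (F n.+1)`_k = motzkin_coef n k.
Proof.
move=> F1 FS n; elim/ltn_ind: n => -[|n] IHn k.
  rewrite F1 coef1 /motzkin_coef /catalan; case: k => [|k] //.
  by rewrite mulnS bin0n mulr0 mul0r.
rewrite FS coefD coefMn coefXM IHn // -mulr_natl.
case: k => [|k] /=.
  rewrite addr0 /motzkin_coef !bin0 !mulr1.
  have -> : n.+1%:Z - (2 * 0)%:Z = 1 + (n%:Z - (2 * 0)%:Z) by lia.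
  by rewrite [RHS]expfzDr // expr1z.
rewrite motzkin_coef_rec; congr (_ + _).
rewrite coef_sum; apply: eq_bigr => -[i /= i_lt] _; rewrite coefM.
apply: eq_bigr => a _; rewrite IHn; last by lia.
have -> : (n - i = (n.-1 - i).+1)%N by lia.
by rewrite IHn //; lia.
Qed.

(** * Words avoiding 231 *)

(** The default [x] of [head] makes the last letter contribute 0. *)
Fixpoint big_descents (w : seq nat) : nat :=
  if w is x :: w' then (((head x w').+1 < x) + big_descents w')%N else 0%N.

Fixpoint avoids231 (w : seq nat) : bool :=
  if w is x :: w' then
    pairwise (fun y z => ~~ (z < x < y)%N) w' && avoids231 w'
  else true.

Lemma big_descents_cat (u v : seq nat) : allrel ltn u v ->
  big_descents (u ++ v) = (big_descents u + big_descents v)%N.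
Proof.
elim: u => //= x u IHu; rewrite allrel_consl => /andP[x_lt uv].
rewrite IHu // addnA; congr (_ + _ + _)%N.
by case: u {IHu uv} => //= ; case: v x_lt => //= y v /andP[xy _]; lia.
Qed.

(** An occurrence of 231 meeting both words would have its smallest letter in [v] and a larger one
    in [u]. *)
Lemma avoids231_cat (u v : seq nat) : allrel ltn u v ->
  avoids231 (u ++ v) = avoids231 u && avoids231 v.
Proof.
elim: u => //= x u IHu; rewrite allrel_consl => /andP[x_lt uv].
rewrite IHu // pairwise_cat andbA; congr (_ && _); congr (_ && _).
have -> : pairwise (fun y z => ~~ (z < x < y)%N) v.
  apply/(pairwiseP 0%N) => i j _ j_lt _.
  by have := all_nthP 0%N x_lt j j_lt; lia.
rewrite andbT; case: allrelP => // -[] y z _ /(allP x_lt); lia.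
Qed.

(** With [x] in the role of the 2, no letter above [x] may precede a letter below it. *)
Lemma pairwise_split (x : nat) (w : seq nat) : x \notin w ->
  pairwise (fun y z => ~~ (z < x < y)%N) w ->
  w = [seq y <- w | y < x]%N ++ [seq y <- w | x < y]%N.
Proof.
elim: w => //= y w IHw; rewrite inE negb_or => /andP[xy xw] /andP[yw pw].
have [lt_yx|le_xy] := ltnP y x.
  by rewrite ltnNge ltnW //= -IHw.
have lt_xy : (x < y)%N by rewrite ltn_neqAle xy.
rewrite lt_xy; have /eqP E : [seq y <- w | y < x]%N == [::].
  rewrite -(negbK (_ == _)) -has_filter -all_predC; apply/allP => z /(allP yw) /=.
  by rewrite lt_xy andbT.
by rewrite {1}(IHw xw pw) E.
Qed.

(* The 231-avoiding arrangements of [a, ..., a + n - 1], for [n <= f]: below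
   its first letter [a + i], such a word lists all smaller letters before all
   larger ones. *)
Fixpoint words231 (f a n : nat) : seq (seq nat) :=
  match f, n with
  | f'.+1, n'.+1 =>
    [seq (a + i)%N :: p.1 ++ p.2 | i <- iota 0 n'.+1,
       p <- [seq (u, v) | u <- words231 f' a i,
                          v <- words231 f' (a + i).+1 (n' - i)]]
  | _, _ => [:: [::]]
  end.

Lemma words231S (f a n : nat) :
  words231 f.+1 a n.+1 =
    [seq (a + i)%N :: p.1 ++ p.2 | i <- iota 0 n.+1,
       p <- [seq (u, v) | u <- words231 f a i,
                          v <- words231 f (a + i).+1 (n - i)]].
Proof. by []. Qed.

Lemma iota_split (a i n : nat) : (i <= n)%N ->
  iota a n.+1 = iota a i ++ (a + i)%N :: iota (a + i).+1 (n - i).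
Proof.
by move=> le_in; rewrite -[in LHS](subnKC le_in) -addnS iotaD.
Qed.

Lemma allrel_ltn_iota (u v : seq nat) (a b i m : nat) :
  {subset u <= iota a i} -> {subset v <= iota b m} -> (a + i <= b)%N ->
  allrel ltn u v.
Proof.
move=> su sv le_ib; apply/allrelP => y z /su + /sv.
by rewrite !mem_iota; lia.
Qed.

Lemma allrel_cons_iota (u v : seq nat) (a i m : nat) :
  perm_eq u (iota a i) -> perm_eq v (iota (a + i).+1 m) ->
  allrel ltn ((a + i)%N :: u) v.
Proof.
move=> pu pv; apply: (@allrel_ltn_iota _ _ a (a + i).+1 i.+1 m) => [z|z|].
- by rewrite inE (perm_mem pu) !mem_iota; lia.
- by rewrite (perm_mem pv).
- by rewrite addnS.
Qed.

Lemma avoids231_cons (x : nat) (u v : seq nat) :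
  all (fun y => y < x)%N u -> allrel ltn (x :: u) v ->
  avoids231 (x :: u ++ v) = avoids231 u && avoids231 v.
Proof.
move=> ux uv; rewrite -cat_cons avoids231_cat //=; congr (_ && _).
rewrite (_ : pairwise _ u = true) //.
apply/(pairwiseP 0%N) => i j i_lt _ _.
by have := all_nthP 0%N ux i i_lt; lia.
Qed.

Lemma mem_words231 (f a n : nat) (w : seq nat) : (n <= f)%N ->
  (w \in words231 f a n) = perm_eq w (iota a n) && avoids231 w.
Proof.
have nil0 b z : (z \in [:: [::]]) = perm_eq z (iota b 0) && avoids231 z.
  rewrite inE; apply/eqP/andP => [-> //|[/perm_size/size0nil]] //.
elim: f a n w => [|f IHf] a [|n] w le_nf; rewrite ?nil0 //.
rewrite words231S.
apply/allpairsPdep/andP => [[i [p [+ + Dw]]]|[pw avw]].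
  rewrite mem_iota add0n ltnS => le_in /allpairsP[[u v] [uW vW Dp]]; rewrite /= in uW vW.
  have -> : w = (a + i)%N :: u ++ v by rewrite Dw Dp.
  move: uW vW; rewrite !IHf; [|lia..] => /andP[pu au] /andP[pv av].
  split; last first.
    rewrite avoids231_cons ?au ?av //; last exact: allrel_cons_iota pu pv.
    by apply/allP => y; rewrite (perm_mem pu) mem_iota; lia.
    rewrite (iota_split _ _ _ le_in).
  rewrite perm_sym -cat_rcons perm_sym -cat_cons; apply: perm_cat pv.
  by rewrite perm_sym perm_rcons perm_cons perm_sym.
case: w => [|x w] in pw avw *; first by have /perm_size := pw.
have : x \in iota a n.+1 by rewrite -(perm_mem pw) mem_head.
rewrite mem_iota => x_in.
have [i Dx le_in] : exists2 i, x = (a + i)%N & (i <= n)%N.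
  by exists (x - a)%N; lia.
have xw : x \notin w.
  by have := perm_uniq pw; rewrite iota_uniq /= => /andP[].
have /andP[px avw'] := avw; have {avw'} avw : avoids231 w := avw'.
have Dw := pairwise_split _ _ xw px.
set u := [seq y <- w | y < x]%N in Dw.
set v := [seq y <- w | x < y]%N in Dw.
(* Filtering both sides of [pw] by comparison with [x] identifies the letters of each block. *)
have pu : perm_eq u (iota a i).
  have := perm_filter (fun y => y < x)%N pw.
  rewrite (iota_split _ _ _ le_in) /= filter_cat /= -Dx ltnn -/u.
  rewrite (@eq_in_filter _ _ predT (iota a i)) => [|y]; last first.
    by rewrite mem_iota Dx /=; lia.
  rewrite (@eq_in_filter _ _ pred0 (iota x.+1 _)) => [|y]; last first.
    by rewrite mem_iota /=; lia.
  by rewrite filter_predT filter_pred0 cats0.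
have pv : perm_eq v (iota (a + i).+1 (n - i)).
  have := perm_filter (fun y => x < y)%N pw.
  rewrite (iota_split _ _ _ le_in) /= filter_cat /= -Dx ltnn -/v.
  rewrite (@eq_in_filter _ _ pred0 (iota a i)) => [|y]; last first.
    by rewrite mem_iota Dx /=; lia.
  rewrite (@eq_in_filter _ _ predT (iota x.+1 _)) => [|y]; last first.
    by rewrite mem_iota /=; lia.
  by rewrite filter_predT filter_pred0.
have uv : allrel ltn u v.
  by have := allrel_cons_iota _ _ _ _ _ pu pv; rewrite allrel_consl => /andP[].
move: avw; rewrite Dw avoids231_cat // => /andP[au av].
exists i, (u, v); split; rewrite ?Dx //; first by rewrite mem_iota; lia.
apply/allpairsP; exists (u, v); split => //=; rewrite IHf ?pu ?pv //; lia.
Qed.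

(** A word determines its decomposition: the first letter gives [i], which is the length of [u] and
    hence locates the cut. *)
Lemma words231_uniq (f a n : nat) : (n <= f)%N -> uniq (words231 f a n).
Proof.
elim: f a n => [|f IHf] a [|n] le_nf //.
rewrite words231S; apply: allpairs_uniq_dep => [|i|].
- exact: iota_uniq.
- rewrite mem_iota => i_lt; apply: allpairs_uniq => [||[? ?] [? ?] //];
  by apply: IHf; lia.
move=> ? ? /allpairsPdep[i [p [i_in p_in ->]]] /allpairsPdep[j [q [j_in q_in ->]]].
move=> [/addnI eq_ij]; case: _ / eq_ij in q_in j_in *.
move: i_in p_in q_in; rewrite mem_iota => i_in.
move=> /allpairsP[[u v] /= [uW _ ->]] /allpairsP[[u' v'] /= [uW' _ ->]].
move: uW uW'; rewrite !mem_words231; [|lia..].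
move=> /andP[/perm_size su _] /andP[/perm_size su' _] /eqP.
by rewrite eqseq_cat ?su // => /andP[/eqP -> /eqP ->].
Qed.

(** * Generating polynomials of big descents *)

Definition bdes_poly (f a n : nat) : {poly rat} :=
  \sum_(w <- words231 f a n) 'X^(big_descents w).

(** The prefixed letter is the maximum, so for [n <= f] this is the coefficient of [x^(n+1)] in
    [M]. *)
Definition top_bdes_poly (f a n : nat) : {poly rat} :=
  \sum_(w <- words231 f a n) 'X^(big_descents ((a + n)%N :: w)).

Lemma sum_words231S (f a n : nat) (g : seq nat -> {poly rat}) :
  \sum_(w <- words231 f.+1 a n.+1) g w =
    \sum_(i < n.+1) \sum_(u <- words231 f a i)
      \sum_(v <- words231 f (a + i).+1 (n - i)) g ((a + i)%N :: u ++ v).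
Proof.
rewrite words231S big_allpairs_dep /= -/(iota 0 n.+1).
rewrite -[iota 0 n.+1]/(index_iota 0 n.+1) big_mkord.
by apply: eq_bigr => i _; rewrite big_allpairs_dep.
Qed.

(** This is [F = 1 + M F]: cutting [m u v] at the ascent before [v] leaves [m u], which starts with
    its maximum. *)
Lemma bdes_polyS (f a n : nat) : (n <= f)%N ->
  bdes_poly f.+1 a n.+1 =
    \sum_(i < n.+1) top_bdes_poly f a i * bdes_poly f (a + i).+1 (n - i).
Proof.
move=> le_nf; rewrite /bdes_poly sum_words231S; apply: eq_bigr => -[i /= i_le] _.
rewrite mulr_suml; apply: eq_big_seq => u.
rewrite mem_words231 => [/andP[pu _]|]; last by lia.
rewrite mulr_sumr; apply: eq_big_seq => v.
rewrite mem_words231 => [/andP[pv _]|]; last by lia.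
rewrite -[X in 'X^X]/(big_descents (((a + i)%N :: u) ++ v)).
by rewrite big_descents_cat ?(allrel_cons_iota _ _ _ _ _ pu pv) // exprD.
Qed.

(** This is the equation of [M]. Behind the new maximum stands a word with first letter [a + i]; the
    junction is a big descent exactly when [i < n]. The term [i = n] of [bdes_polyS], where [v] is
    empty, collects the words starting with their maximum. *)
Lemma top_bdes_polyS (f a n : nat) : (n <= f)%N ->
  top_bdes_poly f.+1 a n.+1 =
    top_bdes_poly f a n + 'X * (bdes_poly f.+1 a n.+1 - top_bdes_poly f a n).
Proof.
move=> le_nf; have P0 : bdes_poly f (a + n).+1 (n - n) = 1.
  by rewrite subnn /bdes_poly; case: f {le_nf}=> *; rewrite big_seq1.
rewrite bdes_polyS // big_ord_recr /= P0 mulr1 addrK addrC.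
have -> : top_bdes_poly f.+1 a n.+1 = \sum_(i < n.+1)
    'X^(i < n)%N * (top_bdes_poly f a i * bdes_poly f (a + i).+1 (n - i)).
  rewrite /top_bdes_poly sum_words231S.
  apply: eq_bigr => -[i /= i_le] _.
  rewrite mulr_suml mulr_sumr; apply: eq_big_seq => u.
  rewrite mem_words231 => [/andP[pu _]|]; last by lia.
  rewrite !mulr_sumr; apply: eq_big_seq => v.
  rewrite mem_words231 => [/andP[pv _]|]; last by lia.
  rewrite -[X in 'X^(_ + X)]/(big_descents (((a + i)%N :: u) ++ v)).
  rewrite big_descents_cat ?(allrel_cons_iota _ _ _ _ _ pu pv) //.
  by rewrite addnS ltnS ltn_add2l !exprD.
rewrite big_ord_recr /= P0 mulr1 ltnn mul1r mulr_sumr; congr (_ + _).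
by apply: eq_bigr => i _; rewrite ltn_ord.
Qed.

(** The recurrences produce blocks with other fuels and shifted letters; this reduces them to
    sequences indexed by length alone. *)
Lemma bdes_poly_fuel (f f' a a' n : nat) : (n <= f)%N -> (n <= f')%N ->
  bdes_poly f a n = bdes_poly f' a' n /\
  top_bdes_poly f a n = top_bdes_poly f' a' n.
Proof.
elim: f f' a a' n => [|f IHf] [|f'] a a' [|n] // le_nf le_nf';
  try by rewrite /bdes_poly /top_bdes_poly !big_seq1 /= !addn0 !ltnNge !leqnSn.
have E : bdes_poly f.+1 a n.+1 = bdes_poly f'.+1 a' n.+1.
  rewrite !bdes_polyS //; apply: eq_bigr => -[i /= i_le] _.
  have [| |_ ->] := IHf f' a a' i; [lia|lia|].
  by have [| |-> _] := IHf f' (a + i).+1 (a' + i).+1 (n - i)%N; [lia|lia|].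
split=> //; rewrite !top_bdes_polyS // E.
by have [| |_ ->] := IHf f' a a' n.
Qed.

Lemma coef_bdes_poly (n k : nat) :
  (bdes_poly n 0 n)`_k = motzkin_coef n.-1 k.
Proof.
pose F m := bdes_poly m 0 m.
pose M m := if m is m'.+1 then top_bdes_poly m' 0 m' else 0.
have F0 : F 0 = 1 by rewrite /F /bdes_poly /= big_seq1.
have M1 : M 1 = 1 by rewrite /M /top_bdes_poly /= big_seq1.
have FS m : F m.+1 = \sum_(i < m.+1) M i.+1 * F (m - i)%N.
  rewrite /F bdes_polyS //; apply: eq_bigr => -[i /= i_le] _.
  have [| |_ ->] := bdes_poly_fuel m i 0 0 i; [lia|lia|].
  by have [| |-> _] := bdes_poly_fuel m (m - i) i.+1 0 (m - i); [lia|lia|].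
have MS m : M m.+2 = M m.+1 + 'X * (F m.+1 - M m.+1).
  exact: top_bdes_polyS.
have F1 : F 1 = 1 by rewrite FS big_ord1 M1 F0 mulr1.
case: n => [|n] /=; last first.
  by apply: (coef_quadratic_recurrence F F1); apply: (quadratic_recurrence F M).
(* For [n = 0] the index [n.-1] is again 0, and the formula holds because [F 0 = 1 = F 1]. *)
by rewrite -/(F 0) -(coef_quadratic_recurrence F F1 (quadratic_recurrence F M _ _ _ _ _)) // F0 F1.
Qed.

Lemma coef_bdes_poly_count (f a n k : nat) :
  (bdes_poly f a n)`_k =
    (count (fun w => big_descents w == k) (words231 f a n))%:R.
Proof.
rewrite coef_sum -sum1_count natr_sum [RHS]big_mkcond.
by apply: eq_bigr => w _; rewrite coefXn eq_sym; case: eqP.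
Qed.

(** * Permutations as words *)

Definition word_of_perm (n : nat) (s : 'S_n) : seq nat :=
  [seq val (s i) | i <- enum 'I_n].

Lemma size_word_of_perm (n : nat) (s : 'S_n) : size (word_of_perm n s) = n.
Proof. by rewrite size_map size_enum_ord. Qed.

Lemma nth_word_of_perm (n : nat) (s : 'S_n) (i : 'I_n) :
  nth 0%N (word_of_perm n s) i = s i.
Proof. by rewrite (nth_map i) ?size_enum_ord // nth_ord_enum. Qed.

Lemma word_of_perm_inj (n : nat) : injective (word_of_perm n).
Proof.
move=> s t eq_st; apply/permP => i; apply: val_inj.
by rewrite /= -!nth_word_of_perm eq_st.
Qed.

Lemma perm_word_of_perm (n : nat) (s : 'S_n) :
  perm_eq (word_of_perm n s) (iota 0 n).
Proof.
apply: uniq_perm; rewrite ?iota_uniq //.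
  by rewrite map_inj_uniq ?enum_uniq // => i j /val_inj/perm_inj.
move=> x; rewrite mem_iota add0n; apply/mapP/idP => [[i _ ->]|x_lt].
  exact: ltn_ord.
exists (s^-1%g (Ordinal x_lt)); rewrite ?mem_enum //.
by rewrite permKV.
Qed.

Lemma word_of_perm_surj (n : nat) (w : seq nat) : perm_eq w (iota 0 n) ->
  exists s : 'S_n, w = word_of_perm n s.
Proof.
move=> pw; have sw : size w = n by rewrite (perm_size pw) size_iota.
have w_lt (i : 'I_n) : (nth 0 w i < n)%N.
  by have := mem_nth 0%N (_ : i < size w)%N; rewrite (perm_mem pw) mem_iota sw;
    apply.
have w_inj : injective (fun i => Ordinal (w_lt i)).
  move=> i j [/eqP]; rewrite nth_uniq ?sw ?(perm_uniq pw) ?iota_uniq //.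
  by move/eqP/val_inj.
exists (perm w_inj); apply: (@eq_from_nth _ 0%N) => [|i].
  by rewrite size_word_of_perm.
by rewrite sw => i_lt; rewrite (nth_word_of_perm _ _ (Ordinal i_lt)) permE.
Qed.

Lemma big_descents_nth (w : seq nat) :
  big_descents w =
    (\sum_(i < size w) ((i.+1 < size w) && ((nth 0 w i.+1).+1 < nth 0 w i)))%N.
Proof.
elim: w => [|x w IHw] /=; first by rewrite big_ord0.
rewrite big_ord_recl IHw /=; congr addn.
by case: w {IHw} => //=; lia.
Qed.

Lemma bdes_word_of_perm (n : nat) (s : 'S_n) :
  bdes s = big_descents (word_of_perm n s).
Proof.
rewrite big_descents_nth size_word_of_perm /bdes -sum1_card [LHS]big_mkcond.
apply: eq_bigr => i _; rewrite inE nth_word_of_perm.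
suff -> : big_descent s i =
    (i.+1 < n)%N && ((nth 0 (word_of_perm n s) i.+1).+1 < s i)%N.
  by case: (_ && _).
apply/existsP/andP => [[j /andP[/eqP Dj lt_ji]]|[i1_lt lt_i]].
  by rewrite -Dj ltn_ord nth_word_of_perm -addn1.
exists (Ordinal i1_lt); rewrite eqxx addn1.
by rewrite -(nth_word_of_perm _ s (Ordinal i1_lt)).
Qed.

Lemma avoids231P (w : seq nat) :
  reflect (forall i j k, i < j -> j < k -> k < size w ->
             ~~ (nth 0 w k < nth 0 w i < nth 0 w j))%N
          (avoids231 w).
Proof.
elim: w => [|x w IHw] /=; first by apply: ReflectT => i j [].
apply: (iffP andP) => [[/(pairwiseP 0%N) px /IHw aw]|H].
  case=> [|i] [|j] [|k] //= ij jk k_lt; last exact: aw.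
  by apply: px => //; rewrite inE; lia.
split; last by apply/IHw => i j k ij jk k_lt; apply: (H i.+1 j.+1 k.+1).
apply/(pairwiseP 0%N) => j k _ k_lt jk; exact: (H 0 j.+1 k.+1)%N.
Qed.

Lemma avoids_word_of_perm (n : nat) (s : 'S_n) :
  avoids [:: 2; 3; 1]%N s = avoids231 (word_of_perm n s).
Proof.
apply/existsPn/avoids231P => [H i j k ij jk|H f].
  rewrite size_word_of_perm => k_lt.
  pose i' := Ordinal (ltn_trans ij (ltn_trans jk k_lt)).
  pose j' := Ordinal (ltn_trans jk k_lt); pose k' := Ordinal k_lt.
  have := H [ffun x : 'I_3 => nth k' [:: i'; j'; k'] x].
  apply: contraNN => /andP[].
  rewrite (nth_word_of_perm _ s i') (nth_word_of_perm _ s j').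
  rewrite (nth_word_of_perm _ s k') => ki ij'.
  apply/andP; split; apply/forallP => -[[|[|[|//]]] /= x_lt];
    apply/forallP => -[[|[|[|//]]] /= y_lt] //; rewrite ?ffunE /=; lia.
apply/negP => /andP[/forallP inc /forallP pat].
pose x0 : 'I_3 := @Ordinal 3 0 isT; pose x1 : 'I_3 := @Ordinal 3 1 isT.
pose x2 : 'I_3 := @Ordinal 3 2 isT.
have lt01 : (f x0 < f x1)%N by have /forallP/(_ x1) := inc x0.
have lt12 : (f x1 < f x2)%N by have /forallP/(_ x2) := inc x1.
have := H _ _ _ lt01 lt12; rewrite size_word_of_perm !nth_word_of_perm ltn_ord.
(* The comparisons 1 < 2 and 2 < 3 in the pattern give the two inequalities that [H] forbids. *)
have /forallP/(_ x0)/eqP/= <- := pat x2; have /forallP/(_ x1)/eqP/= <- := pat x0.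
by move/(_ isT).
Qed.

(** Both sides are lengths of duplicate-free lists with the same members. *)
Lemma b_count_words231 (n k : nat) :
  b n k [:: 2; 3; 1]%N =
    count (fun w => big_descents w == k) (words231 n 0 n).
Proof.
rewrite -size_filter /b cardE -(size_map (word_of_perm n)).
apply/perm_size/uniq_perm.
- by rewrite map_inj_uniq ?enum_uniq //; apply: word_of_perm_inj.
- exact/filter_uniq/words231_uniq.
move=> w; rewrite mem_filter mem_words231 //.
apply/mapP/andP => [[s + ->]|[bw /andP[/word_of_perm_surj[s Dw] aw]]].
  rewrite mem_enum inE avoids_word_of_perm bdes_word_of_perm => /andP[-> ->].
  by rewrite perm_word_of_perm.
exists s => //.
by rewrite mem_enum inE avoids_word_of_perm bdes_word_of_perm -Dw aw.
Qed.

Theorem corollary2p5 (n k : nat) :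
  (b n k [:: 2; 3; 1]%N)%:R =
    (2 : rat) ^ (n.-1%:Z - (2 * k)%:Z) / (k%:R + 1)
      * 'C(n.-1, 2 * k)%:R * 'C(2 * k, k)%:R.
Proof.
rewrite b_count_words231 -(coef_bdes_poly_count n 0) coef_bdes_poly.
by rewrite /motzkin_coef /catalan natr1; ring.
Qed.
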